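(* Let $R$ be an associative ring with unit, let $\mathcal{B}$ be a class of right $R$-modules, and let $\mathrm{Ch}(\mathcal{B})$ be the class of complexes of right $R$-modules all of whose components belong to $\mathcal{B}$. Then every Gorenstein $\mathrm{Ch}(\mathcal{B})$-flat complex is a complex of Gorenstein $\mathcal{B}$-flat modules.
   Context: Complexes have differentials $\partial_m\colon X_m\to X_{m-1}$; $Z_m$ = cycles, $B_m$ = boundaries; $\mathrm{Ch}(R)$ is the category of complexes of left $R$-modules. For $X\in\mathrm{Ch}(R^{op})$, $Y\in\mathrm{Ch}(R)$, let $X\otimes^{\cdot}Y$ be the usual tensor product, $(X\otimes^{\cdot}Y)_m=\bigoplus_kX_k\otimes_RY_{m-k}$, differential $x\otimes y\mapsto\partial x\otimes y+(-1)^kx\otimes\partial y$ ($x\in X_k$); the modified tensor product $X\otimes Y$ has $(X\otimes Y)_m=(X\otimes^{\cdot}Y)_m/B_m(X\otimes^{\cdot}Y)$ and differential $x\otimes y\mapsto\partial x\otimes y$. A complex $F\in\mathrm{Ch}(R)$ is flat if $-\otimes F$ is exact (equivalently, $F$ is exact with flat cycles). A left module $M$ is Gorenstein $\mathcal{B}$-flat if $M=Z_0(F)$ for some exact complex $F$ of flat modules such that $B\otimes_RF$ is exact for all $B\in\mathcal{B}$. For a class $\mathbf{B}\subseteq\mathrm{Ch}(R^{op})$, a complex $X\in\mathrm{Ch}(R)$ is Gorenstein $\mathbf{B}$-flat if $X=Z_0(F_\bullet)$ for some exact $F_\bullet\in\mathrm{Ch}(\mathrm{Ch}(R))$ with flat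 complexes as terms such that $B\otimes F_\bullet$ is exact for all $B\in\mathbf{B}$. *)

(* Defs.v *)
From HB Require Import structures.
From mathcomp Require Import all_boot all_order all_algebra.
From mathcomp Require Import boolp classical_sets functions.
From mathcomp Require Import cardinality fsbigop.

Set Implicit Arguments.
Unset Strict Implicit.
Unset Printing Implicit Defensive.

Import GRing.Theory Quotient.

Local Open Scope classical_set_scope.
Local Open Scope ring_scope.

(* Left R-modules are [lmodType R]; right R-modules are [lmodType R^c], the
   product x a being written (a : R^c) *: x.  [pzRingType] is the class of
   associative rings with unit, the zero ring included. *)

Definition dprod (I : Type) (A : I -> zmodType) : Type := forall i, A i.

Section DirectProduct.
Variables (I : Type) (A : I -> zmodType).

HB.instance Definition _ := Choice.copy (dprod A) (forall i, A i).

Definition dprod_zero : dprod A := fun i => 0.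
Definition dprod_opp (u : dprod A) : dprod A := fun i => - u i.
Definition dprod_add (u v : dprod A) : dprod A := fun i => u i + v i.

Fact dprod_addA : associative dprod_add.
Proof.
by move=> u v w; apply: functional_extensionality_dep => i; exact: addrA.
Qed.
Fact dprod_addC : commutative dprod_add.
Proof.
by move=> u v; apply: functional_extensionality_dep => i; exact: addrC.
Qed.
Fact dprod_add0 : left_id dprod_zero dprod_add.
Proof.
by move=> u; apply: functional_extensionality_dep => i; exact: add0r.
Qed.
Fact dprod_addN : left_inverse dprod_zero dprod_opp dprod_add.
Proof.
by move=> u; apply: functional_extensionality_dep => i; exact: addNr.
Qed.

HB.instance Definition _ := GRing.isZmodule.Build (dprod A)
  dprod_addA dprod_addC dprod_add0 dprod_addN.

Definition fin_supp : {pred dprod A} :=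
  fun u => `[< finite_set [set i | u i != 0] >].

Fact fin_supp_closed : zmod_closed fin_supp.
Proof.
split=> [|u v].
  apply/asboolP; suff -> : [set i | (0 : dprod A) i != 0] = set0 by [].
  by apply/seteqP; split=> i //=; rewrite eqxx.
move=> /asboolP fu /asboolP fv; apply/asboolP.
have: finite_set ([set i | u i != 0] `|` [set i | v i != 0]).
  by rewrite finite_setU.
apply: sub_finite_set => i /=.
have -> : (u - v) i = u i - v i by [].
have [->|] := eqVneq (u i) 0; last by left.
by rewrite sub0r oppr_eq0; right.
Qed.

HB.instance Definition _ :=
  GRing.isZmodClosed.Build (dprod A) fin_supp fin_supp_closed.

End DirectProduct.

Record dsum (I : Type) (A : I -> zmodType) :=
  DSum { dsum_val : dprod A; _ : dsum_val \in @fin_supp I A }.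

Definition dsum_app (I : Type) (A : I -> zmodType) (u : dsum A) :
  forall i, A i :=
  dsum_val u.
Coercion dsum_app : dsum >-> Funclass.

Section DirectSum.
Variables (I : choiceType) (A : I -> zmodType).

HB.instance Definition _ := [isSub for @dsum_val I A].
HB.instance Definition _ := [Choice of dsum A by <:].
HB.instance Definition _ := [SubChoice_isSubZmodule of dsum A by <:].

Lemma dsumP (u v : dsum A) : (forall i, u i = v i) -> u = v.
Proof. by move=> uv; apply/val_inj/functional_extensionality_dep. Qed.

Lemma dsumBE (u v : dsum A) i : (u - v) i = u i - v i.
Proof. by []. Qed.

Lemma dsumDE (u v : dsum A) i : (u + v) i = u i + v i.
Proof. by []. Qed.

Lemma dsum_fin (u : dsum A) : finite_set [set i | u i != 0].
Proof. by case: u => u /= /asboolP. Qed.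

Section Injection.
Variable i : I.

Fact dsum_inj_subproof (x : A i) :
  (dfwith (fun j => 0 : A j) x : dprod A) \in @fin_supp I A.
Proof.
apply/asboolP; apply: (sub_finite_set _ (finite_set1 i)) => j /=.
by case: dfwithP => // k _; rewrite eqxx.
Qed.

Definition dsum_inj (x : A i) : dsum A := DSum (dsum_inj_subproof x).

Fact dsum_inj_is_zmod_morphism : zmod_morphism dsum_inj.
Proof.
move=> x y; apply: dsumP => j; rewrite dsumBE /dsum_app /=.
have [<-|ij] := eqVneq i j; first by rewrite !dfwith_in.
by rewrite !dfwith_out // subr0.
Qed.

HB.instance Definition _ := GRing.isZmodMorphism.Build (A i) (dsum A)
  dsum_inj dsum_inj_is_zmod_morphism.

End Injection.

Section Lift.
Variables (C : zmodType) (f : forall i, {additive A i -> C}).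

Definition dsum_lift (u : dsum A) : C := \sum_(i \in [set: I]) f i (u i).

Fact dsum_lift_is_zmod_morphism : zmod_morphism dsum_lift.
Proof.
have liftD (u v : dsum A) : dsum_lift (u + v) = dsum_lift u + dsum_lift v.
  pose S := [set i | u i != 0] `|` [set i | v i != 0].
  have fS : finite_set S by rewrite finite_setU; split; exact: dsum_fin.
  have liftS (w : dsum A) : (forall i, u i = 0 -> v i = 0 -> w i = 0) ->
      dsum_lift w = \sum_(i \in S) f i (w i).
    move=> w0; apply/esym/fsbig_widen => // i [_ /= /not_orP[]].
    by move=> /negP/negPn/eqP ui /negP/negPn/eqP vi; rewrite w0 ?raddf0.
  rewrite !liftS // => [|i ui vi]; last by rewrite dsumDE ui vi addr0.
  by rewrite -fsbig_split //; apply: eq_fsbigr => i _; rewrite dsumDE raddfD.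
by move=> u v; apply/eqP; rewrite -(subr_eq _ _ (- _)) opprK -liftD subrK.
Qed.

HB.instance Definition _ := GRing.isZmodMorphism.Build (dsum A) C
  dsum_lift dsum_lift_is_zmod_morphism.

Lemma dsum_lift_inj i (x : A i) : dsum_lift (dsum_inj x) = f i x.
Proof.
rewrite /dsum_lift -(fsbig_widen [set i]) => [|//|j [_ /= /eqP ji]].
  by rewrite fsbig_set1 /dsum_app /= dfwith_in.
by rewrite /dsum_app /= dfwith_out ?raddf0 // eq_sym.
Qed.

End Lift.

Lemma dsum_ind (P : dsum A -> Prop) :
  P 0 -> (forall u v, P u -> P v -> P (u + v)) ->
  (forall i (x : A i), P (dsum_inj x)) -> forall u, P u.
Proof.
move=> P0 PD Pinj u; have /finite_seqP[s us] := dsum_fin u.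
have -> : u = \sum_(i <- undup s) dsum_inj (u i).
  apply: dsumP => j.
  rewrite (big_morph (fun w : dsum A => w j) (id1 := 0) (op1 := +%R)) //.
  have inj0 i : i != j -> dsum_inj (u i) j = 0.
    by move=> ij; rewrite /dsum_app /= dfwith_out.
  have [js|jNs] := boolP (j \in undup s).
    rewrite (bigD1_seq j) ?undup_uniq //= big1 ?addr0 //.
    by rewrite {2}/dsum_app /= dfwith_in.
  rewrite big_seq big1 => [|i i_s]; last first.
    by apply: inj0; apply: contraNneq jNs => <-.
  apply/eqP; apply: contraNT jNs => uj.
  have: [set i | u i != 0] j by [].
  by rewrite us /= mem_undup.
by apply: big_ind => // i _.
Qed.

End DirectSum.

Section GeneratedSubgroup.
Variables (V : zmodType) (G : V -> Prop).

Definition gen_subgroup : {pred V} :=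
  fun v => `[< forall S : {pred V}, zmod_closed S ->
                 (forall w, G w -> w \in S) -> v \in S >].

Fact gen_subgroup_closed : zmod_closed gen_subgroup.
Proof.
split=> [|u v]; first by apply/asboolP => S [].
move=> /asboolP uG /asboolP vG; apply/asboolP => S clS GS.
by apply: clS.2; [exact: uG | exact: vG].
Qed.

HB.instance Definition _ :=
  GRing.isZmodClosed.Build V gen_subgroup gen_subgroup_closed.

Lemma mem_gen_subgroup v : G v -> v \in gen_subgroup.
Proof. by move=> Gv; apply/asboolP => S _; apply. Qed.

End GeneratedSubgroup.

Section QuotientLift.
Variables (V C : zmodType) (S : zmodClosed V) (f : {additive V -> C}).
Hypothesis fS0 : forall v, v \in S -> f v = 0.

Definition quot_lift of (forall v, v \in S -> f v = 0) :=
  fun u : quot S => f (repr u).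

Local Notation lift := (quot_lift fS0).

Lemma quot_liftE v : lift (\pi_(quot S) v)%qT = f v.
Proof.
apply/eqP; rewrite -subr_eq0 -raddfB /=; apply/eqP/fS0.
by rewrite idealrBE reprK.
Qed.

Fact quot_lift_is_zmod_morphism : zmod_morphism lift.
Proof.
by elim/quotW => u; elim/quotW => v; rewrite -raddfB !quot_liftE raddfB.
Qed.

HB.instance Definition _ := GRing.isZmodMorphism.Build (quot S) C
  lift quot_lift_is_zmod_morphism.

End QuotientLift.

Section Tensor.
Variables (R : pzRingType) (M : lmodType R^c) (N : lmodType R).

Definition free_ab : zmodType := dsum (fun _ : (M * N)%type => int).

Definition free_gen (x : M) (y : N) : free_ab :=
  @dsum_inj _ (fun _ : (M * N)%type => int) (x, y) 1.

Inductive tensor_rel : free_ab -> Prop :=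
| tensor_relDl x x' y :
    tensor_rel (free_gen (x + x') y - (free_gen x y + free_gen x' y))
| tensor_relDr x y y' :
    tensor_rel (free_gen x (y + y') - (free_gen x y + free_gen x y'))
| tensor_relZ (a : R) x y :
    tensor_rel (free_gen ((a : R^c) *: x) y - free_gen x (a *: y)).

Definition tensor : zmodType := quot (gen_subgroup tensor_rel).

Definition tens (x : M) (y : N) : tensor := (\pi_tensor (free_gen x y))%qT.

Lemma tensDl x x' y : tens (x + x') y = tens x y + tens x' y.
Proof.
rewrite /tens -raddfD; apply/eqP; rewrite -idealrBE.
exact/mem_gen_subgroup/tensor_relDl.
Qed.

Lemma tensDr x y y' : tens x (y + y') = tens x y + tens x y'.
Proof.
rewrite /tens -raddfD; apply/eqP; rewrite -idealrBE.
exact/mem_gen_subgroup/tensor_relDr.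
Qed.

Lemma tensZ (a : R) x y : tens ((a : R^c) *: x) y = tens x (a *: y).
Proof.
apply/eqP; rewrite -idealrBE.
exact/mem_gen_subgroup/tensor_relZ.
Qed.

Lemma tens0l y : tens 0 y = 0.
Proof. by apply: (addrI (tens 0 y)); rewrite -tensDl !addr0. Qed.

Lemma tens0r x : tens x 0 = 0.
Proof. by apply: (addrI (tens x 0)); rewrite -tensDr !addr0. Qed.

Section Lift.
Variables (C : zmodType) (b : M -> N -> C).

Definition balanced : Prop :=
  [/\ forall x x' y, b (x + x') y = b x y + b x' y,
      forall x y y', b x (y + y') = b x y + b x y' &
      forall (a : R) x y, b ((a : R^c) *: x) y = b x (a *: y)].

Definition free_lift : free_ab -> C :=
  dsum_lift (fun p : (M * N)%type => *~%R (b p.1 p.2) : {additive int -> C}).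

Fact free_lift_is_zmod_morphism : zmod_morphism (free_lift).
Proof. exact: raddfB. Qed.

HB.instance Definition _ := GRing.isZmodMorphism.Build free_ab C
  free_lift free_lift_is_zmod_morphism.

Lemma free_lift_gen x y : free_lift (free_gen x y) = b x y.
Proof. by rewrite /free_lift /free_gen /= dsum_lift_inj /= mulr1z. Qed.

Hypothesis bal : balanced.

Fact free_lift_eq0 u : u \in gen_subgroup tensor_rel -> free_lift u = 0.
Proof.
move=> /asboolP /(_ [pred v | free_lift v == 0]) H; apply/eqP/H => [|w].
  split=> [|v w /eqP v0 /eqP w0]; first by rewrite inE raddf0.
  by rewrite inE raddfB /= v0 w0 subr0.
have [bDl bDr bZ] := bal.
by case=> *; rewrite inE raddfB subr_eq0 ?(raddfD free_lift) /= ?free_lift_gen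
  ?bDl ?bDr ?bZ.
Qed.

Definition tens_lift : tensor -> C := quot_lift free_lift_eq0.

Fact tens_lift_is_zmod_morphism : zmod_morphism (tens_lift).
Proof. exact: raddfB. Qed.

HB.instance Definition _ := GRing.isZmodMorphism.Build tensor C
  tens_lift tens_lift_is_zmod_morphism.

Lemma tens_liftE x y : tens_lift (tens x y) = b x y.
Proof. exact: etrans (quot_liftE free_lift_eq0 _) (free_lift_gen x y). Qed.

End Lift.

Lemma tensMzl x y n : tens (x *~ n) y = tens x y *~ n.
Proof.
have tD : zmod_morphism (tens^~ y).
  by move=> u v; apply/eqP; rewrite eq_sym subr_eq -tensDl subrK.
pose h := GRing.isZmodMorphism.Build _ _ (tens^~ y) tD.
pose g : {additive M -> tensor} := HB.pack (tens^~ y) h.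
exact: (raddfMz g).
Qed.

Lemma tensor_ind (P : tensor -> Prop) :
  P 0 -> (forall u v, P u -> P v -> P (u + v)) ->
  (forall x y, P (tens x y)) -> forall u, P u.
Proof.
move=> P0 PD Pt; elim/quotW => u; elim/dsum_ind: u.
- by rewrite raddf0.
- by move=> u v Pu Pv; rewrite raddfD; apply: PD.
move=> [x y] n; rewrite -[n]intz.
have -> : @dsum_inj _ (fun _ : (M * N)%type => int) (x, y) n%:~R
        = free_gen x y *~ n by rewrite -raddfMz.
by rewrite raddfMz -[X in X *~ n]/(tens x y) -tensMzl; apply: Pt.
Qed.

End Tensor.
Arguments tens {R M N} x y.

Section TensorMap.
Variables (R : pzRingType) (M M' : lmodType R^c) (N N' : lmodType R).
Variables (f : {linear M -> M'}) (g : {linear N -> N'}).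

Fact tens_map_balanced : balanced (fun x y => tens (f x) (g y)).
Proof.
split=> *.
- by rewrite raddfD tensDl.
- by rewrite raddfD tensDr.
- by rewrite !linearZ /= tensZ.
Qed.

Definition tens_map : tensor M N -> tensor M' N' :=
  tens_lift tens_map_balanced.

Fact tens_map_is_zmod_morphism : zmod_morphism (tens_map).
Proof. exact: raddfB. Qed.

HB.instance Definition _ := GRing.isZmodMorphism.Build
  (tensor M N) (tensor M' N')
  tens_map tens_map_is_zmod_morphism.

Lemma tens_mapE x y : tens_map (tens x y) = tens (f x) (g y).
Proof. exact: tens_liftE. Qed.

End TensorMap.

Definition exact_at (A B C : zmodType) (f : A -> B) (g : B -> C) : Prop :=
  forall b, g b = 0 <-> exists a, f a = b.

Definition short_exact (A B C : zmodType) (f : A -> B) (g : B -> C) : Prop :=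
  [/\ injective f, exact_at f g & forall c, exists b, g b = c].

(* The differential X_i -> X_(i-1) is given as a family [diff X e] indexed by
   the proofs e : i = j + 1, so that no transport along equalities of degrees
   is ever needed.  Since [int] has unique identity proofs this is a single map
   for each i. *)
Record complex (R : pzRingType) := Complex {
  obj :> int -> lmodType R;
  diff : forall i j : int, i = j + 1 -> {linear obj i -> obj j};
  diffK : forall (i j k : int) (e : i = j + 1) (e' : j = k + 1) x,
    diff e' (diff e x) = 0
}.
Arguments diff {R} c {i j} e.

Record chain_map (R : pzRingType) (X Y : complex R) := ChainMap {
  chain_fun :> forall m, {linear X m -> Y m};
  chain_diff : forall (i j : int) (e : i = j + 1) x,
    chain_fun j (diff X e x) = diff Y e (chain_fun i x)
}.

Record zcomplex := ZComplex {
  zobj :> int -> zmodType;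
  zdiff : forall i j : int, i = j + 1 -> {additive zobj i -> zobj j};
  zdiffK : forall (i j k : int) (e : i = j + 1) (e' : j = k + 1) x,
    zdiff e' (zdiff e x) = 0
}.
Arguments zdiff z {i j} e.

Record zchain_map (X Y : zcomplex) := ZChainMap {
  zchain_fun :> forall m, {additive X m -> Y m};
  zchain_diff : forall (i j : int) (e : i = j + 1) x,
    zchain_fun j (zdiff X e x) = zdiff Y e (zchain_fun i x)
}.

(* diff X (pred_deg i) : X_i -> X_(i-1) *)
Definition pred_deg (i : int) : i = i - 1 + 1 := esym (subrK 1 i).

Definition exact_complex (R : pzRingType) (X : complex R) : Prop :=
  forall (i j k : int) (e : i = j + 1) (e' : j = k + 1),
    exact_at (diff X e) (diff X e').

(* Kernels and cokernels, hence exactness, are computed degreewise in Ch(R)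
   and in Ch(Z). *)
Definition ch_exact (R : pzRingType) (X Y Z : complex R)
    (f : chain_map X Y) (g : chain_map Y Z) : Prop :=
  forall m, exact_at (f m) (g m).

Definition ch_short_exact (R : pzRingType) (X Y Z : complex R)
    (f : chain_map X Y) (g : chain_map Y Z) : Prop :=
  forall m, short_exact (f m) (g m).

Definition zch_exact (X Y Z : zcomplex)
    (f : zchain_map X Y) (g : zchain_map Y Z) : Prop :=
  forall m, exact_at (f m) (g m).

Definition zch_short_exact (X Y Z : zcomplex)
    (f : zchain_map X Y) (g : zchain_map Y Z) : Prop :=
  forall m, short_exact (f m) (g m).

Definition chain_id (R : pzRingType) (X : complex R) : chain_map X X :=
  @ChainMap R X X (fun m => idfun : {linear X m -> X m}) (fun _ _ _ _ => erefl).

Definition chain_iso (R : pzRingType) (X Y : complex R) : Prop :=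
  exists f : chain_map X Y, forall m, bijective (f m).

Definition mod_iso (R : pzRingType) (M N : lmodType R) : Prop :=
  exists f : {linear M -> N}, bijective f.

Section Kernel.
Variables (R : pzRingType) (M N : lmodType R) (f : {linear M -> N}).

Definition ker_pred : {pred M} := fun x => f x == 0.

Fact ker_pred_closed : subsemimod_closed ker_pred.
Proof.
split=> [|a x /eqP fx].
  split=> [|x y /eqP fx /eqP fy]; apply/eqP; first exact: raddf0.
  by rewrite raddfD /= fx fy addr0.
by apply/eqP; rewrite linearZ /= fx scaler0.
Qed.

Record kernel := Kernel { ker_val : M; _ : ker_val \in ker_pred }.

HB.instance Definition _ := [isSub for ker_val].
HB.instance Definition _ := [Choice of kernel by <:].
HB.instance Definition _ :=
  GRing.SubChoice_isSubLmodule.Build R M ker_pred kernel ker_pred_closed.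

End Kernel.

(* Z_m(X). *)
Definition cycles (R : pzRingType) (X : complex R) (m : int) : lmodType R :=
  kernel (diff X (pred_deg m)).

Section ChainKernel.
Variables (R : pzRingType) (X Y : complex R) (f : chain_map X Y).

Section Differential.
Variables (i j : int) (e : i = j + 1).

Fact chain_ker_subproof (x : kernel (f i)) :
  diff X e (ker_val x) \in ker_pred (f j).
Proof.
apply/eqP; rewrite chain_diff.
by have /eqP -> : ker_val x \in ker_pred (f i) := valP x; rewrite raddf0.
Qed.

Definition chain_ker_diff (x : kernel (f i)) : kernel (f j) :=
  Kernel (chain_ker_subproof x).

Fact chain_ker_diff_is_linear : linear chain_ker_diff.
Proof. by move=> a x y; apply: val_inj; rewrite /= linearP. Qed.

HB.instance Definition _ := GRing.isLinear.Build R (kernel (f i)) (kernel (f j))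
  _ chain_ker_diff chain_ker_diff_is_linear.

End Differential.

Fact chain_ker_diffK (i j k : int) (e : i = j + 1) (e' : j = k + 1) x :
  chain_ker_diff e' (chain_ker_diff e x) = 0.
Proof. by apply: val_inj => /=; apply: diffK. Qed.

Definition chain_kernel : complex R :=
  @Complex R (fun m => kernel (f m)) (fun i j e => chain_ker_diff e)
    chain_ker_diffK.

End ChainKernel.

Definition signz (k : int) (V : zmodType) (u : V) : V :=
  u *~ (-1) ^ k.

Fact signz_is_zmod_morphism k V : zmod_morphism (@signz k V).
Proof. by move=> u v; rewrite /signz mulrzBl. Qed.

HB.instance Definition _ k V := GRing.isZmodMorphism.Build V V
  (@signz k V) (@signz_is_zmod_morphism k V).

Lemma raddf_signz k (V W : zmodType) (f : {additive V -> W}) u :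
  f (signz k u) = signz k (f u).
Proof. exact: raddfMz. Qed.

(* (X \otimes^. Y)_m is the direct sum of the X_k \otimes Y_l with k + l = m;
   indexing it by the pairs (k, l) avoids the degree m - k. *)
Definition bideg (m : int) : choiceType :=
  {p : (int * int)%type | p.1 + p.2 == m}.

Section Total.
Variables (R : pzRingType) (X : complex R^c) (Y : complex R).

Definition tens_at m (p : bideg m) : zmodType :=
  tensor (X (val p).1) (Y (val p).2).

Definition tot (m : int) : zmodType := dsum (@tens_at m).

Section Differential.
Variables (m n : int) (e : m = n + 1).

Fact bideg_l_subproof (p : bideg m) : ((val p).1 - 1) + (val p).2 == n.
Proof. by case: p => -[k l] /= /eqP; rewrite e addrAC => ->; rewrite addrK. Qed.

Fact bideg_r_subproof (p : bideg m) : (val p).1 + ((val p).2 - 1) == n.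
Proof. by case: p => -[k l] /= /eqP; rewrite e addrA => ->; rewrite addrK. Qed.

Definition bideg_l (p : bideg m) : bideg n :=
  exist _ ((val p).1 - 1, (val p).2) (bideg_l_subproof p).

Definition bideg_r (p : bideg m) : bideg n :=
  exist _ ((val p).1, (val p).2 - 1) (bideg_r_subproof p).

(* x \otimes y |-> dx \otimes y *)
Definition tot_diff_l : tot m -> tot n :=
  dsum_lift (fun p : bideg m =>
    @dsum_inj _ (@tens_at n) (bideg_l p) \o
      tens_map (diff X (pred_deg (val p).1)) idfun
    : {additive tens_at p -> tot n}).

(* x \otimes y |-> (-1)^k x \otimes dy for x in X_k *)
Definition tot_diff_r : tot m -> tot n :=
  dsum_lift (fun p : bideg m =>
    @signz (val p).1 _ \o
      (@dsum_inj _ (@tens_at n) (bideg_r p) \o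
       tens_map idfun (diff Y (pred_deg (val p).2)))
    : {additive tens_at p -> tot n}).

Fact tot_diff_l_is_zmod_morphism : zmod_morphism (tot_diff_l).
Proof. exact: raddfB. Qed.

HB.instance Definition _ := GRing.isZmodMorphism.Build (tot m) (tot n)
  tot_diff_l tot_diff_l_is_zmod_morphism.

Fact tot_diff_r_is_zmod_morphism : zmod_morphism (tot_diff_r).
Proof. exact: raddfB. Qed.

HB.instance Definition _ := GRing.isZmodMorphism.Build (tot m) (tot n)
  tot_diff_r tot_diff_r_is_zmod_morphism.

Lemma tot_diff_l_inj (p : bideg m) (u : tens_at p) :
  tot_diff_l (dsum_inj u) =
  @dsum_inj _ (@tens_at n) (bideg_l p)
    (tens_map (diff X (pred_deg (val p).1)) idfun u).
Proof. exact: dsum_lift_inj. Qed.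

Lemma tot_diff_r_inj (p : bideg m) (u : tens_at p) :
  tot_diff_r (dsum_inj u) =
  signz (val p).1 (@dsum_inj _ (@tens_at n) (bideg_r p)
    (tens_map idfun (diff Y (pred_deg (val p).2)) u)).
Proof. exact: dsum_lift_inj. Qed.

Definition tot_diff : tot m -> tot n := tot_diff_l \+ tot_diff_r.
Fact tot_diff_is_zmod_morphism : zmod_morphism (tot_diff).
Proof. exact: raddfB. Qed.

HB.instance Definition _ := GRing.isZmodMorphism.Build (tot m) (tot n)
  tot_diff tot_diff_is_zmod_morphism.

Lemma tot_diffE u : tot_diff u = tot_diff_l u + tot_diff_r u.
Proof. by []. Qed.

End Differential.

Lemma tot_inj_irrelevance m (v : (int * int)%type)
    (h h' : v.1 + v.2 == m) (u : tensor (X v.1) (Y v.2)) :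
  @dsum_inj _ (@tens_at m) (exist _ v h) u =
  @dsum_inj _ (@tens_at m) (exist _ v h') u.
Proof. by rewrite (bool_irrelevance h h'). Qed.

Lemma tot_ind m (P : tot m -> Prop) :
  P 0 -> (forall u v, P u -> P v -> P (u + v)) ->
  (forall (p : bideg m) x y, P (@dsum_inj _ (@tens_at m) p (tens x y))) ->
  forall u, P u.
Proof.
move=> P0 PD Pt; apply: dsum_ind => // p; elim/tensor_ind => //.
  by rewrite raddf0.
by move=> u v Pu Pv; rewrite raddfD; apply: PD.
Qed.

Section Square.
Variables (i j k : int) (e : i = j + 1) (e' : j = k + 1).

Lemma tot_diff_ll u : tot_diff_l e' (tot_diff_l e u) = 0.
Proof.
elim/tot_ind: u => [|u v IHu IHv|p x y]; first by rewrite !raddf0.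
  by rewrite !raddfD /= IHu IHv addr0.
by rewrite !tot_diff_l_inj !tens_mapE diffK tens0l raddf0.
Qed.

Lemma tot_diff_rr u : tot_diff_r e' (tot_diff_r e u) = 0.
Proof.
elim/tot_ind: u => [|u v IHu IHv|p x y]; first by rewrite !raddf0.
  by rewrite !raddfD /= IHu IHv addr0.
rewrite tot_diff_r_inj raddf_signz /= tot_diff_r_inj !tens_mapE.
by rewrite diffK tens0r !raddf0.
Qed.

Lemma tot_diff_lr u : tot_diff_r e' (tot_diff_l e u) =
  - tot_diff_l e' (tot_diff_r e u).
Proof.
elim/tot_ind: u => [|u v IHu IHv|p x y]; first by rewrite !raddf0.
  by rewrite !raddfD /= IHu IHv.
rewrite tot_diff_l_inj tot_diff_r_inj !tens_mapE /=.
rewrite tot_diff_r_inj raddf_signz /= tot_diff_l_inj !tens_mapE /=.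
rewrite /signz exprzDr ?unitrN1 // mulrN1 mulrNz; congr (- (_ *~ _)).
exact: tot_inj_irrelevance.
Qed.

Fact tot_diffK u : tot_diff e' (tot_diff e u) = 0.
Proof.
rewrite !tot_diffE !raddfD /= tot_diff_ll tot_diff_rr tot_diff_lr.
by rewrite add0r addr0 subrr.
Qed.

End Square.

Definition total_tensor : zcomplex :=
  @ZComplex tot (fun i j e => tot_diff e) tot_diffK.

End Total.
Arguments tot_diff_l {R} X Y {m n} e _.
Arguments tot_diff_r {R} X Y {m n} e _.
Arguments tot_diff {R} X Y {m n} e _.

Section TotalMap.
Variables (R : pzRingType) (X X' : complex R^c) (Y Y' : complex R).
Variables (f : chain_map X X') (g : chain_map Y Y').

Definition tot_map m : tot X Y m -> tot X' Y' m :=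
  dsum_lift (fun p : bideg m =>
    @dsum_inj _ (@tens_at R X' Y' m) p \o
      tens_map (f (val p).1) (g (val p).2)
    : {additive tens_at X Y p -> tot X' Y' m}).

Arguments tot_map m _ : clear implicits.

Fact tot_map_is_zmod_morphism m : zmod_morphism (tot_map m).
Proof. exact: raddfB. Qed.

HB.instance Definition _ m := GRing.isZmodMorphism.Build
  (tot X Y m) (tot X' Y' m)
  (tot_map m) (@tot_map_is_zmod_morphism m).

Lemma tot_map_inj m (p : bideg m) (u : tens_at X Y p) :
  tot_map m (dsum_inj u) =
  @dsum_inj _ (@tens_at R X' Y' m) p (tens_map (f (val p).1) (g (val p).2) u).
Proof. exact: dsum_lift_inj. Qed.

Section Commutation.
Variables (i j : int) (e : i = j + 1).

Lemma tot_map_diff_l u :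
  tot_map j (tot_diff_l X Y e u) = tot_diff_l X' Y' e (tot_map i u).
Proof.
elim/tot_ind: u => [|u v IHu IHv|p x y]; first by rewrite !raddf0.
  by rewrite !raddfD /= IHu IHv.
rewrite tot_diff_l_inj !tot_map_inj tot_diff_l_inj.
by rewrite !tens_mapE /= chain_diff.
Qed.

Lemma tot_map_diff_r u :
  tot_map j (tot_diff_r X Y e u) = tot_diff_r X' Y' e (tot_map i u).
Proof.
elim/tot_ind: u => [|u v IHu IHv|p x y]; first by rewrite !raddf0.
  by rewrite !raddfD /= IHu IHv.
rewrite tot_diff_r_inj raddf_signz /= !tot_map_inj tot_diff_r_inj.
by rewrite !tens_mapE /= chain_diff.
Qed.

Fact tot_map_diff u :
  tot_map j (zdiff (total_tensor X Y) e u) =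
  zdiff (total_tensor X' Y') e (tot_map i u).
Proof. by rewrite /= !tot_diffE raddfD /= tot_map_diff_l tot_map_diff_r. Qed.

End Commutation.

Definition total_tensor_map :
    zchain_map (total_tensor X Y) (total_tensor X' Y') :=
  @ZChainMap (total_tensor X Y) (total_tensor X' Y') tot_map tot_map_diff.

End TotalMap.
Arguments tot_map {R X X' Y Y'} f g m _.

Section Boundaries.
Variables (X : zcomplex) (m : int).

Definition zboundaries : {pred X m} :=
  fun y => `[< exists x : X (m + 1), zdiff X erefl x = y >].

Fact zboundaries_closed : zmod_closed zboundaries.
Proof.
split=> [|u v]; first by apply/asboolP; exists 0; rewrite raddf0.
move=> /asboolP[x <-] /asboolP[y <-]; apply/asboolP; exists (x - y).
by rewrite raddfB.
Qed.

HB.instance Definition _ :=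
  GRing.isZmodClosed.Build (X m) zboundaries zboundaries_closed.

End Boundaries.
Arguments zboundaries X m : clear implicits.

Section Modified.
Variables (R : pzRingType) (X : complex R^c) (Y : complex R).

Definition mtens (m : int) : zmodType :=
  quot (zboundaries (total_tensor X Y) m).

Definition mtens_pi m : tot X Y m -> mtens m := \pi_(mtens m)%qT.

Arguments mtens_pi m _ : clear implicits.

Fact mtens_pi_is_zmod_morphism m : zmod_morphism (mtens_pi m).
Proof. exact: raddfB. Qed.

HB.instance Definition _ m := GRing.isZmodMorphism.Build (tot X Y m) (mtens m)
  (mtens_pi m) (@mtens_pi_is_zmod_morphism m).
Lemma mtens_eq0 m u :
  u \in zboundaries (total_tensor X Y) m -> mtens_pi m u = 0.
Proof.
move=> uB; rewrite -(raddf0 (mtens_pi m)); apply/eqP.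
by rewrite -idealrBE subr0.
Qed.

Section Differential.
Variables (i j : int) (e : i = j + 1).

Fact mtens_diff_subproof u : u \in zboundaries (total_tensor X Y) i ->
  (mtens_pi j \o tot_diff_l X Y e) u = 0.
Proof.
move=> /asboolP[x <-]; apply: mtens_eq0; apply/asboolP.
subst i; exists (- tot_diff_l X Y erefl x).
rewrite raddfN /= !tot_diffE [in RHS]raddfD /= !tot_diff_ll !add0r.
by rewrite tot_diff_lr opprK.
Qed.

(* x \otimes y |-> dx \otimes y *)
Definition mtens_diff : mtens i -> mtens j :=
  quot_lift mtens_diff_subproof.
Fact mtens_diff_is_zmod_morphism : zmod_morphism (mtens_diff).
Proof. exact: raddfB. Qed.

HB.instance Definition _ := GRing.isZmodMorphism.Build (mtens i) (mtens j)
  mtens_diff mtens_diff_is_zmod_morphism.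

Lemma mtens_diffE u :
  mtens_diff (mtens_pi i u) = mtens_pi j (tot_diff_l X Y e u).
Proof. exact: (quot_liftE mtens_diff_subproof). Qed.

End Differential.

Fact mtens_diffK (i j k : int) (e : i = j + 1) (e' : j = k + 1) u :
  mtens_diff e' (mtens_diff e u) = 0.
Proof.
elim/quotW: u => u.
rewrite -[(\pi_(_) u)%qT]/(mtens_pi i u) !mtens_diffE.
by rewrite tot_diff_ll raddf0.
Qed.

Definition modified_tensor : zcomplex :=
  @ZComplex mtens (fun i j e => mtens_diff e) mtens_diffK.

End Modified.
Arguments mtens_diff {R} X Y {i j} e _.
Arguments mtens_pi {R} X Y m _.

Section ModifiedMap.
Variables (R : pzRingType) (X X' : complex R^c) (Y Y' : complex R).
Variables (f : chain_map X X') (g : chain_map Y Y').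

Fact mtens_map_subproof m u : u \in zboundaries (total_tensor X Y) m ->
  (mtens_pi X' Y' m \o tot_map f g m) u = 0.
Proof.
move=> /asboolP[x <-]; apply: mtens_eq0; apply/asboolP.
by exists (tot_map f g (m + 1) x); rewrite tot_map_diff.
Qed.

Definition mtens_map m : mtens X Y m -> mtens X' Y' m :=
  quot_lift (@mtens_map_subproof m).
Arguments mtens_map m _ : clear implicits.

Fact mtens_map_is_zmod_morphism m : zmod_morphism (mtens_map m).
Proof. exact: raddfB. Qed.

HB.instance Definition _ m := GRing.isZmodMorphism.Build
  (mtens X Y m) (mtens X' Y' m)
  (mtens_map m) (@mtens_map_is_zmod_morphism m).

Lemma mtens_mapE m u :
  mtens_map m (mtens_pi X Y m u) = mtens_pi X' Y' m (tot_map f g m u).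
Proof. exact: (quot_liftE (@mtens_map_subproof m)). Qed.

Fact mtens_map_diff (i j : int) (e : i = j + 1) u :
  mtens_map j (zdiff (modified_tensor X Y) e u) =
  zdiff (modified_tensor X' Y') e (mtens_map i u).
Proof.
elim/quotW: u => u.
rewrite -[(\pi_(_) u)%qT]/(mtens_pi X Y i u) /= mtens_mapE.
by rewrite !mtens_diffE mtens_mapE tot_map_diff_l.
Qed.

Definition modified_tensor_map :
    zchain_map (modified_tensor X Y) (modified_tensor X' Y') :=
  @ZChainMap (modified_tensor X Y) (modified_tensor X' Y')
    mtens_map mtens_map_diff.

End ModifiedMap.
Arguments mtens_map {R X X' Y Y'} f g m _.

Definition flat_module (R : pzRingType) (N : lmodType R) : Prop :=
  forall (M' M M'' : lmodType R^c)
      (f : {linear M' -> M}) (g : {linear M -> M''}),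
    short_exact f g ->
    short_exact (tens_map f (idfun : {linear N -> N}))
                (tens_map g (idfun : {linear N -> N})).

Definition flat_complex (R : pzRingType) (F : complex R) : Prop :=
  forall (X' X X'' : complex R^c) (f : chain_map X' X) (g : chain_map X X''),
    ch_short_exact f g ->
    zch_short_exact (modified_tensor_map f (chain_id F))
                    (modified_tensor_map g (chain_id F)).

Definition tensor_exact (R : pzRingType) (B : lmodType R^c) (F : complex R) :
    Prop :=
  forall (i j k : int) (e : i = j + 1) (e' : j = k + 1),
    exact_at (tens_map (idfun : {linear B -> B}) (diff F e))
             (tens_map (idfun : {linear B -> B}) (diff F e')).

Definition gorenstein_flat_module (R : pzRingType) (BB : lmodType R^c -> Prop)
    (M : lmodType R) : Prop :=
  exists F : complex R,
    [/\ exact_complex F, forall m, flat_module (F m),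
        forall B, BB B -> tensor_exact B F & mod_iso M (cycles F 0)].

(* Complexes in Ch(R), that is, objects of Ch(Ch(R)). *)
Record ccomplex (R : pzRingType) := CComplex {
  cobj :> int -> complex R;
  cdiff : forall i j : int, i = j + 1 -> chain_map (cobj i) (cobj j);
  cdiffK : forall (i j k : int) (e : i = j + 1) (e' : j = k + 1) m x,
    cdiff e' m (cdiff e m x) = 0
}.
Arguments cdiff {R} c {i j} e.

Definition exact_ccomplex (R : pzRingType) (F : ccomplex R) : Prop :=
  forall (i j k : int) (e : i = j + 1) (e' : j = k + 1),
    ch_exact (cdiff F e) (cdiff F e').

Definition ccycles (R : pzRingType) (F : ccomplex R) (m : int) : complex R :=
  chain_kernel (cdiff F (pred_deg m)).

Definition modified_exact (R : pzRingType) (B : complex R^c) (F : ccomplex R) :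
    Prop :=
  forall (i j k : int) (e : i = j + 1) (e' : j = k + 1),
    zch_exact (modified_tensor_map (chain_id B) (cdiff F e))
              (modified_tensor_map (chain_id B) (cdiff F e')).

Definition gorenstein_flat_complex (R : pzRingType)
    (BB : complex R^c -> Prop) (X : complex R) : Prop :=
  exists F : ccomplex R,
    [/\ exact_ccomplex F, forall n, flat_complex (F n),
        forall B, BB B -> modified_exact B F & chain_iso X (ccycles F 0)].

Definition Ch_class (R : pzRingType) (BB : lmodType R -> Prop)
    (X : complex R) : Prop :=
  forall m, BB (X m).

(* Main.v *)
Require Import Defs.
From mathcomp Require Import all_boot all_order all_algebra.
From HB Require Import structures.
From mathcomp Require Import boolp.

(** The class [BB] need not contain [0], so the usual disk complex is not
    available; instead, for a right module [M], let [disk M] have [M] in every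
    degree and zero differential except for the identity [M_1 -> M_0].  In
    [disk M \otimes Y] each [x_0 \otimes y] equals [x_1 \otimes dy], so
    [M \otimes Y_l] is a retract of [(disk M \otimes Y)_(l+1)], naturally in
    [M] and [Y].  Exactness passes to retracts, which gives both the flatness
    of the components of a flat complex and the exactness of
    [B \otimes F_l]. *)

Set Implicit Arguments.
Unset Strict Implicit.
Unset Printing Implicit Defensive.

Import GRing.Theory Quotient.

Local Open Scope ring_scope.

(** * Retracts of exact sequences *)

Section Retract.
Variables (A B C A' B' C' : zmodType).
Variables (f : A -> B) (g : B -> C) (f' : A' -> B') (g' : B' -> C').
Variables (iA : A -> A') (iB : B -> B') (iC : {additive C -> C'}).
Variables (rA : A' -> A) (rB : B' -> B) (rC : {additive C' -> C}).
Hypotheses (iAK : cancel iA rA) (iBK : cancel iB rB) (iCK : cancel iC rC).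
Hypotheses (f_i : forall x, f' (iA x) = iB (f x)).
Hypotheses (g_i : forall x, g' (iB x) = iC (g x)).
Hypotheses (f_r : forall x, f (rA x) = rB (f' x)).
Hypotheses (g_r : forall x, g (rB x) = rC (g' x)).

(** Chase [b] into [B'], find a preimage there and retract it to [A]. Zero is compared only at the
    [C] end, so [iC] and [rC] are the additive maps. *)
Lemma exact_at_retract : exact_at f' g' -> exact_at f g.
Proof.
move=> ex b; split=> [gb0|[a <-]].
  have [|a fa] := (ex (iB b)).1; first by rewrite g_i gb0 raddf0.
  by exists (rA a); rewrite f_r fa iBK.
have /ex : exists a', f' a' = iB (f a) by exists (iA a).
by rewrite g_i => gfa0; rewrite -[LHS]iCK gfa0 raddf0.
Qed.

Lemma short_exact_retract : short_exact f' g' -> short_exact f g.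
Proof.
case=> injf ex surjg; split=> [x y fxy||c].
- by apply/(can_inj iAK)/injf; rewrite !f_i fxy.
- exact: exact_at_retract.
by have [b gb] := surjg (iC c); exists (rB b); rewrite g_r gb iCK.
Qed.

End Retract.

(** * The disk complex and its functoriality *)

Section Disk.
Variables (S : pzRingType) (M : lmodType S).

Definition disk_diff (i : int) : {linear M -> M} :=
  if i == 1 then idfun : {linear M -> M} else \0 : {linear M -> M}.

Fact disk_diffK (i j k : int) (e : i = j + 1) (e' : j = k + 1) x :
  disk_diff j (disk_diff i x) = 0.
Proof.
rewrite /disk_diff; have [i1|_] := eqVneq i 1; last exact: raddf0.
(* Two consecutive identities would need [1 = 1 + 1]. *)
by have [j1|//] := eqVneq j 1; move: e; rewrite i1 j1.
Qed.

Definition disk : complex S :=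
  @Complex S (fun=> M) (fun i j e => disk_diff i) disk_diffK.

End Disk.

Section DiskMap.
Variables (S : pzRingType) (M N : lmodType S) (f : {linear M -> N}).

Fact disk_map_diff (i j : int) (e : i = j + 1) x :
  f (diff (disk M) e x) = diff (disk N) e (f x).
Proof. by rewrite /= /disk_diff; case: eqP => //= _; rewrite raddf0. Qed.

Definition disk_map : chain_map (disk M) (disk N) :=
  @ChainMap S (disk M) (disk N) (fun=> f) disk_map_diff.

End DiskMap.

(** * The retraction of the modified tensor product *)

Section DegreeCast.
Variables (S : pzRingType) (Y : complex S).

(** For a bidegree [(1, k)] of total degree [l + 1], the equality [k = l] is only propositional, so
    a transport is required. *)
Definition degree_cast k l (e : k = l) : {linear Y k -> Y l} :=
  match e with erefl => idfun end.

Lemma degree_cast_diff i j k (e : i = j + 1) (ejk : j = k) (e' : i = k + 1) y :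
  degree_cast ejk (diff Y e y) = diff Y e' y.
Proof. by subst k; rewrite (eq_irrelevance e' e). Qed.

(* The retraction sends x_a \otimes y, with y in Y_k, to
   x \otimes disk_coef a k l y; the junk value 0 for a wrong degree k does not
   occur when a + k = l + 1. *)
Definition disk_coef (a k l : int) : {linear Y k -> Y l} :=
  let zero : {linear Y k -> Y l} := \0 in
  if a == 1 then (if @eqP _ k l is ReflectT e then degree_cast e else zero)
  else if a == 0 then
    (if @eqP _ k (l + 1) is ReflectT e then diff Y e else zero)
  else zero.

Lemma disk_coef1 k l (e : k = l) : disk_coef 1 k l = degree_cast e.
Proof.
by rewrite /disk_coef eqxx; case: eqP => // e'; rewrite (eq_irrelevance e' e).
Qed.

Lemma disk_coef0 k l (e : k = l + 1) : disk_coef 0 k l = diff Y e.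
Proof.
by rewrite /disk_coef /=; case: eqP => // e'; rewrite (eq_irrelevance e' e).
Qed.

Lemma disk_coefN a k l y : a != 0 -> a != 1 -> disk_coef a k l y = 0.
Proof. by rewrite /disk_coef => /negPf -> /negPf ->. Qed.

End DegreeCast.

Lemma disk_coef_map (S : pzRingType) (Y Y' : complex S) (g : chain_map Y Y')
    a k l y : g l (disk_coef Y a k l y) = disk_coef Y' a k l (g k y).
Proof.
rewrite /disk_coef; case: ifP => _; [|case: ifP => _; last exact: raddf0].
  by case: eqP => [e|_]; [subst l | exact: raddf0].
by case: eqP => [e|_]; [exact: chain_diff | exact: raddf0].
Qed.

Section DiskTensor.
Variables (R : pzRingType) (M : lmodType R^c) (Y : complex R) (l : int).

Definition tot_disk_retract : tot (disk M) Y (l + 1) -> tensor M (Y l) :=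
  dsum_lift (fun p : bideg (l + 1) =>
    tens_map (idfun : {linear M -> M})
             (disk_coef Y (val p).1 (val p).2 l)
    : {additive tens_at (disk M) Y p -> tensor M (Y l)}).

HB.instance Definition _ := GRing.isZmodMorphism.Build
  (tot (disk M) Y (l + 1)) (tensor M (Y l)) tot_disk_retract (raddfB _).

Lemma tot_disk_retract_inj (p : bideg (l + 1)) x y :
  tot_disk_retract (@dsum_inj _ (@tens_at R (disk M) Y (l + 1)) p (tens x y)) =
  tens (x : M) (disk_coef Y (val p).1 (val p).2 l y).
Proof.
have -> u : tot_disk_retract (@dsum_inj _ (@tens_at R (disk M) Y (l + 1)) p u) =
    tens_map (idfun : {linear M -> M}) (disk_coef Y (val p).1 (val p).2 l) u.
  exact: dsum_lift_inj.
exact: (tens_mapE idfun).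
Qed.

(** On the boundary of [x_a \otimes y]: for [a = 1] the two terms give [x \otimes dy] with opposite
    signs; for [a = 0] only [x \otimes ddy = 0] is left; for other [a] the disk differential and the
    coefficient both vanish. *)
Fact tot_disk_retract_boundary u :
  u \in zboundaries (total_tensor (disk M) Y) (l + 1) ->
  tot_disk_retract u = 0.
Proof.
move=> /asboolP[v <-] /=; elim/tot_ind: v => [|u1 u2 IH1 IH2|p x y].
- by rewrite !raddf0.
- by rewrite (raddfD (tot_diff _ _ _)) raddfD /= IH1 IH2 addr0.
rewrite tot_diffE raddfD /= tot_diff_l_inj tot_diff_r_inj !tens_mapE.
rewrite raddf_signz /= !tot_disk_retract_inj /=.
case: p x y => -[a b] abP /= x y; move/eqP: (abP) => /= ab.
rewrite /disk_diff.
have [a1|aN1] := eqVneq a 1.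
  (* A boundary in degree [l + 1] comes from total degree [l + 1 + 1]. *)
  subst a; have bl : b = l + 1 by apply: (addrI 1); rewrite ab addrC.
  have bl' : b - 1 = l by rewrite bl addrK.
  rewrite (disk_coef0 Y bl) (disk_coef1 Y bl').
  by rewrite (degree_cast_diff _ _ bl) /signz mulrN1z subrr.
rewrite tens0l add0r; have [a0|aN0] := eqVneq a 0.
  subst a; have bl : b - 1 = l + 1 by rewrite -[b]add0r ab addrK.
  by rewrite (disk_coef0 Y bl) diffK tens0r raddf0.
by rewrite disk_coefN // tens0r raddf0.
Qed.

Definition disk_retract : mtens (disk M) Y (l + 1) -> tensor M (Y l) :=
  quot_lift tot_disk_retract_boundary.

HB.instance Definition _ := GRing.isZmodMorphism.Build
  (mtens (disk M) Y (l + 1)) (tensor M (Y l)) disk_retract (raddfB _).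

Lemma disk_retractE u :
  disk_retract (mtens_pi (disk M) Y (l + 1) u) = tot_disk_retract u.
Proof. exact: (quot_liftE tot_disk_retract_boundary). Qed.

Fact bideg1_subproof : (1 + l) == l + 1.
Proof. by rewrite addrC. Qed.

Definition bideg1 : bideg (l + 1) := exist _ (1, l) bideg1_subproof.

(** Disk degree 1 is used because there the coefficient of the retraction is the identity; in disk
    degree 0 it is the differential of [Y]. *)
Definition disk_section : tensor M (Y l) -> mtens (disk M) Y (l + 1) :=
  mtens_pi (disk M) Y (l + 1) \o
  @dsum_inj _ (@tens_at R (disk M) Y (l + 1)) bideg1.

Fact disk_section_is_zmod_morphism : zmod_morphism disk_section.
Proof. by move=> u v; rewrite /disk_section /= !raddfB. Qed.

HB.instance Definition _ := GRing.isZmodMorphism.Build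
  (tensor M (Y l)) (mtens (disk M) Y (l + 1))
  disk_section disk_section_is_zmod_morphism.

Lemma disk_sectionK : cancel disk_section disk_retract.
Proof.
elim/tensor_ind => [|u v IHu IHv|x y]; first by rewrite !raddf0.
  by rewrite !raddfD /= IHu IHv.
rewrite /disk_section /= disk_retractE tot_disk_retract_inj.
by rewrite (disk_coef1 Y erefl).
Qed.

End DiskTensor.
Arguments disk_section {R} M Y l _.
Arguments disk_retract {R} M Y l _.

(** * Naturality of the section and the retraction *)

Section DiskNaturality.
Variables (R : pzRingType) (M M' : lmodType R^c) (Y Y' : complex R).
Variables (f : {linear M -> M'}) (phi : chain_map (disk M) (disk M')).
Variables (g : chain_map Y Y') (l : int).
(** Pointwise agreement covers both [disk_map f] and, for [f] the identity, [chain_id]. *)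
Hypothesis phiE : forall m x, phi m x = f x.

Lemma disk_section_map u :
  mtens_map phi g (l + 1) (disk_section M Y l u) =
  disk_section M' Y' l (tens_map f (g l) u).
Proof.
elim/tensor_ind: u => [|u v IHu IHv|x y]; first by rewrite !raddf0.
  by rewrite !raddfD /= IHu IHv.
by rewrite /disk_section /= mtens_mapE tot_map_inj !tens_mapE /= phiE.
Qed.

Lemma disk_retract_map u :
  tens_map f (g l) (disk_retract M Y l u) =
  disk_retract M' Y' l (mtens_map phi g (l + 1) u).
Proof.
elim/quotW: u => u; rewrite -[(\pi_(_) u)%qT]/(mtens_pi _ _ _ u).
rewrite mtens_mapE !disk_retractE.
elim/tot_ind: u => [|u v IHu IHv|p x y]; first by rewrite !raddf0.
  by rewrite !raddfD /= IHu IHv.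
rewrite tot_map_inj tens_mapE !tot_disk_retract_inj tens_mapE phiE.
by rewrite disk_coef_map.
Qed.

End DiskNaturality.

(** * Descent from complexes to modules *)

Lemma flat_complex_module (R : pzRingType) (F : complex R) (l : int) :
  flat_complex F -> flat_module (F l).
Proof.
move=> flatF M' M M'' f g fg.
(* The sequence of disks is the given one in each degree, hence short exact; degree [l + 1] contains
   the retract. *)
have /(_ (l + 1)) := flatF _ _ _ (disk_map f) (disk_map g) (fun=> fg).
apply: short_exact_retract.
- exact: disk_sectionK.
- exact: disk_sectionK.
- exact: disk_sectionK.
- exact: (@disk_section_map _ _ _ _ _ f (disk_map f) (chain_id F)).
- exact: (@disk_section_map _ _ _ _ _ g (disk_map g) (chain_id F)).
- exact: (@disk_retract_map _ _ _ _ _ f (disk_map f) (chain_id F)).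
- exact: (@disk_retract_map _ _ _ _ _ g (disk_map g) (chain_id F)).
Qed.

(** The complex of flat modules that witnesses Gorenstein flatness in degree [l]. *)
Definition degree_complex (R : pzRingType) (F : ccomplex R) (l : int) :
    complex R :=
  @Complex R (fun n => F n l) (fun i j e => cdiff F e l)
    (fun i j k e e' => cdiffK e e' (m := l)).

Lemma modified_exact_tensor (R : pzRingType) (B : lmodType R^c)
    (F : ccomplex R) (l : int) :
  modified_exact (disk B) F -> tensor_exact B (degree_complex F l).
Proof.
move=> exF i j k e e'; apply: (exact_at_retract (iA := disk_section B (F i) l)
  (iC := disk_section B (F k) l) (rA := disk_retract B (F i) l)
  (rC := disk_retract B (F k) l) (@disk_sectionK _ B (F j) l)
  (@disk_sectionK _ B (F k) l) _ _ _ (exF i j k e e' (l + 1))).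
- exact: (@disk_section_map _ _ _ _ _ idfun (chain_id _) (cdiff F e)).
- exact: (@disk_section_map _ _ _ _ _ idfun (chain_id _) (cdiff F e')).
- exact: (@disk_retract_map _ _ _ _ _ idfun (chain_id _) (cdiff F e)).
Qed.

Theorem lemma2p22 (R : pzRingType) (BB : lmodType R^c -> Prop) (X : complex R) :
  gorenstein_flat_complex (Ch_class BB) X ->
  forall m : int, gorenstein_flat_module BB (X m).
Proof.
move=> [F [exF flatF BF [f bij_f]]] m; exists (degree_complex F m); split.
- by move=> i j k e e'; apply: exF.
- by move=> n; apply: (@flat_complex_module _ (F n)).
(* All components of [disk B] are [B], so it lies in [Ch_class BB]. *)
- by move=> B BB_B; apply/modified_exact_tensor/BF.
(* Kernels are degreewise: [ccycles F 0] in degree [m] is by conversion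
   [cycles (degree_complex F m) 0]. *)
by exists (f m); apply: bij_f.
Qed.
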